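(* Let $A$ be an arbitrary Cayley--Dickson algebra over a field $F$, let $f(x)\in A[x]$ and $\lambda\in A\setminus F$. Then $\lambda$ is a spherical root of $f(x)$ if and only if $f(x)=g(x)\,p_\lambda(x)$ for some $g(x)\in A[x]$.
   Context: For an $F$-algebra $B$ with involution and $\gamma\in F^\times$, the Cayley--Dickson double $B\{\gamma\}$ is $B\times B$ with componentwise linear operations, product $(a,b)(c,d)=(ac+\gamma\bar d b,\ da+b\bar c)$ and involution $\overline{(a,b)}=(\bar a,-b)$. Cayley--Dickson algebras over $F$: $A_1=F[\ell_1:\ell_1^2=\ell_1+\mu]$ with $\mu\in F$, $4\mu+1\neq0$, involution $\overline{\alpha+\beta\ell_1}=(\alpha+\beta)-\beta\ell_1$, and $A_{k+1}=A_k\{\gamma_k\}$, $\gamma_k\in F^\times$; $F$ is identified with $F\cdot1$. These algebras are power-associative. Trace $\mathrm{tr}(\lambda)=\lambda+\bar\lambda\in F$, norm $\mathrm{n}(\lambda)=\bar\lambda\lambda\in F$, characteristic polynomial $p_\lambda(x)=x^2-\mathrm{tr}(\lambda)x+\mathrm{n}(\lambda)\in F[x]$. The polynomial ring $A[x]=A\otimes_F F[x]$ has central indeterminate $x$; every $f\in A[x]$ is written $f(x)=a_mx^m+\dots+a_1x+a_0$ with $a_k\in A$, products are computed by $(ax^i)(bx^j)=(ab)x^{i+j}$ extended bilinearly, and substitution is $f(r)=\sum_k a_k(r^k)$ for $r\in A$. A root $\lambda\in A\setminus F$ of $f$ is a spherical root if every $r\in A$ with $p_\lambda(r)=0$ is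 also a root of $f$. *)

(* Defs.v *)
From HB Require Import structures.
From mathcomp Require Import all_boot all_algebra.
Set Implicit Arguments. Unset Strict Implicit. Unset Printing Implicit Defensive.
Import GRing.Theory.
Local Open Scope ring_scope.

(* Cayley--Dickson algebras over a field F.
   [cd F n] is the carrier of A_{n+1}:
     cd F 0     = F * F        (pairs (a,b) standing for a + b*l1, l1^2 = l1 + mu)
     cd F (m+1) = cd F m * cd F m   (A_{m+2} = A_{m+1}{g m}).
   The parameters are mu : F and g : nat -> F (g m = gamma_{m+1}). *)
Fixpoint cd (F : Type) (n : nat) : Type :=
  match n with 0 => (F * F)%type | m.+1 => (cd F m * cd F m)%type end.

Fixpoint cd_zero (F : fieldType) (n : nat) : cd F n :=
  match n return cd F n with
  | 0 => (0, 0)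
  | m.+1 => (cd_zero F m, cd_zero F m) end.

Fixpoint cd_scalar (F : fieldType) (n : nat) (c : F) : cd F n :=
  match n return cd F n with
  | 0 => (c, 0)
  | m.+1 => (cd_scalar m c, cd_zero F m) end.

Definition cd_one (F : fieldType) (n : nat) : cd F n := cd_scalar n 1.

Fixpoint cd_add (F : fieldType) (n : nat) : cd F n -> cd F n -> cd F n :=
  match n return cd F n -> cd F n -> cd F n with
  | 0 => fun x y => (x.1 + y.1, x.2 + y.2)
  | m.+1 => fun x y => (cd_add x.1 y.1, cd_add x.2 y.2) end.

Fixpoint cd_opp (F : fieldType) (n : nat) : cd F n -> cd F n :=
  match n return cd F n -> cd F n with
  | 0 => fun x => (- x.1, - x.2)
  | m.+1 => fun x => (cd_opp x.1, cd_opp x.2) end.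

Fixpoint cd_scale (F : fieldType) (n : nat) (c : F) : cd F n -> cd F n :=
  match n return cd F n -> cd F n with
  | 0 => fun x => (c * x.1, c * x.2)
  | m.+1 => fun x => (cd_scale c x.1, cd_scale c x.2) end.

(* involution: conj(a + b l1) = (a+b) - b l1 ; conj(a,b) = (conj a, -b) *)
Fixpoint cd_conj (F : fieldType) (n : nat) : cd F n -> cd F n :=
  match n return cd F n -> cd F n with
  | 0 => fun x => (x.1 + x.2, - x.2)
  | m.+1 => fun x => (cd_conj x.1, cd_opp x.2) end.

(* product: (a + b l1)(c + d l1) = (ac + mu bd) + (ad + bc + bd) l1;
   (a,b)(c,d) = (ac + gamma * conj(d) b, d a + b conj(c)) *)
Fixpoint cd_mul (F : fieldType) (mu : F) (g : nat -> F) (n : nat)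
  : cd F n -> cd F n -> cd F n :=
  match n return cd F n -> cd F n -> cd F n with
  | 0 => fun x y => (x.1 * y.1 + mu * (x.2 * y.2),
                     x.1 * y.2 + x.2 * y.1 + x.2 * y.2)
  | m.+1 => fun x y =>
      (cd_add (cd_mul mu g x.1 y.1) (cd_scale (g m) (cd_mul mu g (cd_conj y.2) x.2)),
       cd_add (cd_mul mu g y.2 x.1) (cd_mul mu g x.2 (cd_conj y.1)))
  end.

Definition cd_inF (F : fieldType) (n : nat) (l : cd F n) : Prop :=
  exists c : F, l = cd_scalar n c.

Definition cd_sum (F : fieldType) (n : nat) (s : seq (cd F n)) : cd F n :=
  foldr (@cd_add F n) (cd_zero F n) s.

(* powers r^0 = 1, r^(k+1) = r^k r (A is power-associative) *)
Fixpoint cd_pow (F : fieldType) (mu : F) (g : nat -> F) (n : nat) (r : cd F n) (k : nat)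
  : cd F n :=
  if k is k'.+1 then cd_mul mu g (cd_pow mu g r k') r else cd_one F n.

(* Polynomials in A[x] (x central): coefficient lists a_0, a_1, ..., a_m *)
Definition cpoly (F : fieldType) (n : nat) := seq (cd F n).

Definition pcoef (F : fieldType) (n : nat) (f : cpoly F n) (i : nat) : cd F n :=
  nth (cd_zero F n) f i.

(* equality of polynomials: all coefficients agree (trailing zeros irrelevant) *)
Definition peq (F : fieldType) (n : nat) (f h : cpoly F n) : Prop :=
  forall i, pcoef f i = pcoef h i.

Definition pmul (F : fieldType) (mu : F) (g : nat -> F) (n : nat) (f h : cpoly F n)
  : cpoly F n :=
  mkseq (fun k => cd_sum [seq cd_mul mu g (pcoef f i) (pcoef h (k - i)) | i <- iota 0 k.+1])
        (size f + size h).-1.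

Definition peval (F : fieldType) (mu : F) (g : nat -> F) (n : nat) (f : cpoly F n) (r : cd F n)
  : cd F n :=
  cd_sum [seq cd_mul mu g (pcoef f k) (cd_pow mu g r k) | k <- iota 0 (size f)].

Definition is_root (F : fieldType) (mu : F) (g : nat -> F) (n : nat) (f : cpoly F n) (r : cd F n)
  : Prop := peval mu g f r = cd_zero F n.

(* characteristic polynomial p_l(x) = x^2 - tr(l) x + n(l),
   tr(l) = l + conj l, n(l) = conj(l) l (both in F = F*1) *)
Definition charpoly (F : fieldType) (mu : F) (g : nat -> F) (n : nat) (l : cd F n)
  : cpoly F n :=
  [:: cd_mul mu g (cd_conj l) l; cd_opp (cd_add l (cd_conj l)); cd_one F n].

Definition spherical_root (F : fieldType) (mu : F) (g : nat -> F) (n : nat)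
  (f : cpoly F n) (l : cd F n) : Prop :=
  [/\ is_root mu g f l, ~ cd_inF l &
      forall r : cd F n, is_root mu g (charpoly mu g l) r -> is_root mu g f r].

(* Main.v *)
Require Import Defs.
From HB Require Import structures.
From mathcomp Require Import all_boot all_algebra.
From mathcomp Require Import zify ring.

(* Since p_l has scalar coefficients, f = h p_l + (a x + b) with f(r) = a r + b
   at every root r of p_l, so the point is that a = 0 as soon as a (r - l) = 0
   for all r with the trace and norm of l. This is shown by induction along
   the Cayley--Dickson doubling. For l = (u, v), move u alone if u is not
   scalar, otherwise move v alone; only norm v matters then, so v may be
   replaced by any nonscalar element of the same norm. If v is scalar and the
   characteristic is not 2, the choice -v is enough. In characteristic 2 a
   nonscalar element of norm 1 exists except in A_1 over F_2 with mu = 0, and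
   there A_2 is handled by exhibiting roots explicitly. *)

Set Implicit Arguments. Unset Strict Implicit. Unset Printing Implicit Defensive.
Import GRing.Theory.
Local Open Scope ring_scope.

(** * Linear structure and involution of the Cayley--Dickson algebras *)

Section Module.
Variable F : fieldType.

(** The same nested products, built as choice types, so that a choice structure can be pulled back
    to [cd F n]; the Z-module structure is built on top of it. *)
Fixpoint cd_choice (n : nat) : choiceType :=
  match n with 0 => (F * F)%type | m.+1 => (cd_choice m * cd_choice m)%type end.

Fixpoint cd_to_choice (n : nat) : cd F n -> cd_choice n :=
  match n with
  | 0 => fun x => x
  | m.+1 => fun x => (cd_to_choice x.1, cd_to_choice x.2) end.

Fixpoint cd_of_choice (n : nat) : cd_choice n -> cd F n :=
  match n with
  | 0 => fun x => x
  | m.+1 => fun x => (cd_of_choice x.1, cd_of_choice x.2) end.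

Lemma cd_to_choiceK n : cancel (@cd_to_choice n) (@cd_of_choice n).
Proof. by elim: n => [|n IHn] [x1 x2] //=; rewrite !IHn. Qed.

HB.instance Definition _ n := Choice.copy (cd F n) (can_type (@cd_to_choiceK n)).

Lemma cd_addA n : associative (@cd_add F n).
Proof. by elim: n => [|n IHn] [? ?] [? ?] [? ?] /=; rewrite ?IHn ?addrA. Qed.

Lemma cd_addC n : commutative (@cd_add F n).
Proof.
elim: n => [|n IHn] [x1 x2] [y1 y2] /=; first by rewrite addrC (addrC x2).
by rewrite IHn (IHn x2).
Qed.

Lemma cd_add0 n : left_id (cd_zero F n) (@cd_add F n).
Proof. by elim: n => [|n IHn] [? ?] /=; rewrite ?IHn ?add0r. Qed.

Lemma cd_addN n : left_inverse (cd_zero F n) (@cd_opp F n) (@cd_add F n).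
Proof. by elim: n => [|n IHn] [? ?] /=; rewrite ?IHn ?addNr. Qed.

HB.instance Definition _ n := GRing.isZmodule.Build (cd F n)
  (@cd_addA n) (@cd_addC n) (@cd_add0 n) (@cd_addN n).

Lemma cd_scaleA n (a b : F) (x : cd F n) :
  cd_scale a (cd_scale b x) = cd_scale (a * b) x.
Proof. by elim: n x => [|n IHn] [? ?] /=; rewrite ?IHn ?mulrA. Qed.

Lemma cd_scale1 n : left_id 1 (@cd_scale F n).
Proof. by elim: n => [|n IHn] [? ?] /=; rewrite ?IHn ?mul1r. Qed.

Lemma cd_scaleDr n : right_distributive (@cd_scale F n) +%R.
Proof.
elim: n => [|n IHn] a [x1 x2] [y1 y2]; first by congr pair; rewrite mulrDr.
by congr pair; exact: IHn.
Qed.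

Lemma cd_scaleDl n (x : cd F n) : {morph (@cd_scale F n)^~ x : a b / a + b}.
Proof.
elim: n x => [|n IHn] [x1 x2] a b; first by congr pair; rewrite mulrDl.
by congr pair; exact: IHn.
Qed.

HB.instance Definition _ n := GRing.Zmodule_isLmodule.Build F (cd F n)
  (@cd_scaleA n) (@cd_scale1 n) (@cd_scaleDr n) (@cd_scaleDl n).

(* Locked, because [cd F n] and [cd_mul] compute on [n]: otherwise rewriting
   with the equations below would match any element up to conversion. *)
Definition cdb (a b : F) : cd F 0 := locked (a, b).
Definition cdp n (x y : cd F n) : cd F n.+1 := locked (x, y).

Lemma cdb_surj (x : cd F 0) : exists a b, x = cdb a b.
Proof. by case: x => a b; exists a, b; rewrite /cdb -lock. Qed.

Lemma cdp_surj n (x : cd F n.+1) : exists y z, x = cdp y z.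
Proof. by case: x => y z; exists y, z; rewrite /cdp -lock. Qed.

Lemma cdp_inj n (x y z t : cd F n) : cdp x y = cdp z t -> x = z /\ y = t.
Proof. by rewrite /cdp -!lock; case. Qed.

Lemma cdbD a b c d : cdb a b + cdb c d = cdb (a + c) (b + d).
Proof. by rewrite /cdb -!lock. Qed.
Lemma cdbN a b : - cdb a b = cdb (- a) (- b).
Proof. by rewrite /cdb -!lock. Qed.
Lemma cdbZ c a b : c *: cdb a b = cdb (c * a) (c * b).
Proof. by rewrite /cdb -!lock. Qed.
Lemma cdpD n (x y z t : cd F n) : cdp x y + cdp z t = cdp (x + z) (y + t).
Proof. by rewrite /cdp -!lock. Qed.
Lemma cdpN n (x y : cd F n) : - cdp x y = cdp (- x) (- y).
Proof. by rewrite /cdp -!lock. Qed.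
Lemma cdpZ n c (x y : cd F n) : c *: cdp x y = cdp (c *: x) (c *: y).
Proof. by rewrite /cdp -!lock. Qed.

Lemma cd_oneS n : cd_one F n.+1 = cdp (cd_one F n) 0.
Proof. by rewrite /cdp -!lock. Qed.

Lemma cd_one0 : cd_one F 0 = cdb 1 0.
Proof. by rewrite /cdb -!lock. Qed.

Lemma cd_scalarZ n (c : F) : cd_scalar n c = c *: cd_one F n.
Proof.
elim: n => [|n IHn].
  by rewrite cd_one0 cdbZ mulr1 mulr0 /cdb -lock.
by rewrite [LHS]/= IHn cd_oneS cdpZ scaler0 /cdp -lock.
Qed.

Lemma cd_conjb a b : cd_conj (cdb a b) = cdb (a + b) (- b).
Proof. by rewrite /cdb -!lock. Qed.
Lemma cd_conjp n (x y : cd F n) : cd_conj (cdp x y) = cdp (cd_conj x) (- y).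
Proof. by rewrite /cdp -!lock. Qed.

Lemma cd_conjD n (x y : cd F n) : cd_conj (x + y) = cd_conj x + cd_conj y.
Proof.
elim: n x y => [|n IHn] x y.
  have [a [b ->]] := cdb_surj x; have [c [d ->]] := cdb_surj y.
  by rewrite cdbD !cd_conjb cdbD; congr cdb; ring.
have [x1 [x2 ->]] := cdp_surj x; have [y1 [y2 ->]] := cdp_surj y.
by rewrite cdpD !cd_conjp cdpD IHn opprD.
Qed.

Lemma cd_conjZ n c (x : cd F n) : cd_conj (c *: x) = c *: cd_conj x.
Proof.
elim: n x => [|n IHn] x.
  by have [a [b ->]] := cdb_surj x; rewrite cdbZ !cd_conjb cdbZ mulrDr mulrN.
by have [y [z ->]] := cdp_surj x; rewrite cdpZ !cd_conjp cdpZ IHn scalerN.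
Qed.

Lemma cd_conjN n (x : cd F n) : cd_conj (- x) = - cd_conj x.
Proof. by rewrite -scaleN1r cd_conjZ scaleN1r. Qed.

Lemma cd_conjB n (x y : cd F n) : cd_conj (x - y) = cd_conj x - cd_conj y.
Proof. by rewrite cd_conjD cd_conjN. Qed.

Lemma cd_conj0 n : cd_conj (0 : cd F n) = 0.
Proof. by rewrite -(scale0r (0 : cd F n)) cd_conjZ !scale0r. Qed.

Lemma cd_conj1 n : cd_conj (cd_one F n) = cd_one F n.
Proof.
elim: n => [|n IHn].
  by rewrite cd_one0 cd_conjb addr0 oppr0.
by rewrite cd_oneS cd_conjp IHn oppr0.
Qed.

Lemma cd_conjK n : involutive (@cd_conj F n).
Proof.
elim: n => [|n IHn] x.
  by have [a [b ->]] := cdb_surj x; rewrite !cd_conjb opprK addrK.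
by have [y [z ->]] := cdp_surj x; rewrite !cd_conjp IHn opprK.
Qed.

End Module.

(** * Product, trace and norm *)

Section Algebra.
Variables (F : fieldType) (mu : F) (g : nat -> F).

Local Notation "x ** y" := (cd_mul mu g x y) (at level 40, left associativity).

Lemma cd_mulb a b c d :
  cdb a b ** cdb c d = cdb (a * c + mu * (b * d)) (a * d + b * c + b * d).
Proof. by rewrite /cdb -!lock. Qed.

Lemma cd_mulp n (a b c d : cd F n) :
  cdp a b ** cdp c d =
  cdp (a ** c + g n *: (cd_conj d ** b)) (d ** a + b ** cd_conj c).
Proof. by rewrite /cdp -!lock. Qed.

(** The two laws are proved jointly: the doubled product contains [d ** a] and [cd_conj d ** b],
    with the factors swapped, so each law on the double needs both laws one level below.
    [cd_mul_scale] and [cd_mul1] are paired for the same reason. *)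
Lemma cd_mul_distr n :
  left_distributive (@cd_mul F mu g n) +%R /\
  right_distributive (@cd_mul F mu g n) +%R.
Proof.
elim: n => [|n [IHl IHr]]; split=> x y z.
- have [a [b ->]] := cdb_surj x; have [c [d ->]] := cdb_surj y.
  have [e [h ->]] := cdb_surj z.
  by rewrite cdbD !cd_mulb cdbD; congr cdb; ring.
- have [a [b ->]] := cdb_surj x; have [c [d ->]] := cdb_surj y.
  have [e [h ->]] := cdb_surj z.
  by rewrite cdbD !cd_mulb cdbD; congr cdb; ring.
- have [a [b ->]] := cdp_surj x; have [c [d ->]] := cdp_surj y.
  have [e [h ->]] := cdp_surj z.
  rewrite cdpD !cd_mulp cdpD !IHl !IHr scalerDr.
  by congr cdp; rewrite addrACA.
- have [a [b ->]] := cdp_surj x; have [c [d ->]] := cdp_surj y.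
  have [e [h ->]] := cdp_surj z.
  rewrite cdpD !cd_mulp cdpD !cd_conjD !IHl !IHr scalerDr.
  by congr cdp; rewrite addrACA.
Qed.

Lemma cd_mulDl n : left_distributive (@cd_mul F mu g n) +%R.
Proof. by case: (cd_mul_distr n). Qed.
Lemma cd_mulDr n : right_distributive (@cd_mul F mu g n) +%R.
Proof. by case: (cd_mul_distr n). Qed.

Lemma cd_mul_scale n c (x y : cd F n) :
  (c *: x) ** y = c *: (x ** y) /\ x ** (c *: y) = c *: (x ** y).
Proof.
elim: n x y => [|n IHn] x y.
  have [a [b ->]] := cdb_surj x; have [d [e ->]] := cdb_surj y.
  by rewrite !cdbZ !cd_mulb cdbZ; split; congr cdb; ring.
have IHl (u v : cd F n) : (c *: u) ** v = c *: (u ** v) by case: (IHn u v).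
have IHr (u v : cd F n) : u ** (c *: v) = c *: (u ** v) by case: (IHn u v).
have [a [b ->]] := cdp_surj x; have [d [e ->]] := cdp_surj y.
rewrite !cdpZ !cd_mulp !cd_conjZ !cdpZ !IHl !IHr !scalerDr.
by rewrite !scalerA ![c * _]mulrC.
Qed.

Lemma cd_mulZl n c (x y : cd F n) : (c *: x) ** y = c *: (x ** y).
Proof. by case: (cd_mul_scale c x y). Qed.
Lemma cd_mulZr n c (x y : cd F n) : x ** (c *: y) = c *: (x ** y).
Proof. by case: (cd_mul_scale c x y). Qed.

Lemma cd_mul0l n (x : cd F n) : 0 ** x = 0.
Proof. by rewrite -(scale0r (0 : cd F n)) cd_mulZl !scale0r. Qed.
Lemma cd_mul0r n (x : cd F n) : x ** 0 = 0.
Proof. by rewrite -(scale0r (0 : cd F n)) cd_mulZr !scale0r. Qed.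
Lemma cd_mulNl n (x y : cd F n) : (- x) ** y = - (x ** y).
Proof. by rewrite -scaleN1r cd_mulZl scaleN1r. Qed.
Lemma cd_mulNr n (x y : cd F n) : x ** (- y) = - (x ** y).
Proof. by rewrite -scaleN1r cd_mulZr scaleN1r. Qed.
Lemma cd_mulBl n (x y z : cd F n) : (x - y) ** z = x ** z - y ** z.
Proof. by rewrite cd_mulDl cd_mulNl. Qed.
Lemma cd_mulBr n (x y z : cd F n) : x ** (y - z) = x ** y - x ** z.
Proof. by rewrite cd_mulDr cd_mulNr. Qed.

Lemma cd_mul1 n (x : cd F n) : cd_one F n ** x = x /\ x ** cd_one F n = x.
Proof.
elim: n x => [|n IHn] x.
  have [a [b ->]] := cdb_surj x; rewrite cd_one0 !cd_mulb.
  by split; congr cdb; ring.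
have IHl u : cd_one F n ** u = u by case: (IHn u).
have IHr u : u ** cd_one F n = u by case: (IHn u).
have [a [b ->]] := cdp_surj x; rewrite cd_oneS !cd_mulp !cd_conj1 !cd_conj0.
by rewrite !IHl !IHr !cd_mul0l !cd_mul0r !scaler0 !addr0 add0r.
Qed.

Lemma cd_mul1l n (x : cd F n) : cd_one F n ** x = x.
Proof. by case: (cd_mul1 x). Qed.
Lemma cd_mul1r n (x : cd F n) : x ** cd_one F n = x.
Proof. by case: (cd_mul1 x). Qed.

Lemma cd_conjM n (x y : cd F n) : cd_conj (x ** y) = cd_conj y ** cd_conj x.
Proof.
elim: n x y => [|n IHn] x y.
  have [a [b ->]] := cdb_surj x; have [c [d ->]] := cdb_surj y.
  by rewrite !(cd_mulb, cd_conjb); congr cdb; ring.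
have [a [b ->]] := cdp_surj x; have [c [d ->]] := cdp_surj y.
rewrite !(cd_mulp, cd_conjp) cd_conjD cd_conjZ cd_conjN !IHn !cd_conjK.
by rewrite !cd_mulNl !cd_mulNr opprK opprD (addrC (- (d ** a))).
Qed.

(** Trace and norm with values in [F] itself; [cd_addconj] and [cd_mulconjl] identify them with
    [x + cd_conj x] and [cd_conj x ** x]. *)
Fixpoint cd_tr n : cd F n -> F :=
  match n return cd F n -> F with
  | 0 => fun x => x.1 *+ 2 + x.2
  | m.+1 => fun x => cd_tr x.1 end.

Fixpoint cd_norm n : cd F n -> F :=
  match n return cd F n -> F with
  | 0 => fun x => x.1 ^+ 2 + x.1 * x.2 - mu * x.2 ^+ 2
  | m.+1 => fun x => cd_norm x.1 - g m * cd_norm x.2 end.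

Lemma cd_trb a b : cd_tr (cdb a b) = a *+ 2 + b. Proof. by rewrite /cdb -!lock. Qed.
Lemma cd_trp n (x y : cd F n) : cd_tr (cdp x y) = cd_tr x. Proof. by rewrite /cdp -!lock. Qed.
Lemma cd_normb a b : cd_norm (cdb a b) = a ^+ 2 + a * b - mu * b ^+ 2.
Proof. by rewrite /cdb -!lock. Qed.
Lemma cd_normp n (x y : cd F n) :
  cd_norm (cdp x y) = cd_norm x - g n * cd_norm y.
Proof. by rewrite /cdp -!lock. Qed.

Lemma cd_addconj n (x : cd F n) : x + cd_conj x = cd_tr x *: cd_one F n.
Proof.
elim: n x => [|n IHn] x.
  have [a [b ->]] := cdb_surj x.
  by rewrite cd_conjb cdbD cd_one0 cdbZ cd_trb; congr cdb; ring.
have [a [b ->]] := cdp_surj x.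
by rewrite cd_conjp cdpD IHn cd_oneS cdpZ scaler0 subrr cd_trp.
Qed.

Lemma cd_mulconjl n (x : cd F n) : cd_conj x ** x = cd_norm x *: cd_one F n.
Proof.
elim: n x => [|n IHn] x.
  have [a [b ->]] := cdb_surj x.
  by rewrite cd_conjb cd_mulb cd_one0 cdbZ cd_normb; congr cdb; ring.
have [a [b ->]] := cdp_surj x.
rewrite cd_conjp cd_mulp cd_mulNr cd_mulNl IHn IHn cd_oneS cdpZ scaler0 cd_normp.
by rewrite subrr scalerN scalerA -scaleNr -scalerDl.
Qed.

(** Multiply [x + cd_conj x], a scalar, by [x] on the right: every element is a root of its own
    characteristic polynomial. *)
Lemma cd_sqr n (x : cd F n) :
  x ** x = cd_tr x *: x - cd_norm x *: cd_one F n.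
Proof.
have -> : cd_tr x *: x = (x + cd_conj x) ** x.
  by rewrite cd_addconj cd_mulZl cd_mul1l.
by rewrite cd_mulDl cd_mulconjl addrK.
Qed.

Lemma cd_tr_conj n (x : cd F n) : cd_tr (cd_conj x) = cd_tr x.
Proof.
elim: n x => [|n IHn] x.
  by have [a [b ->]] := cdb_surj x; rewrite cd_conjb !cd_trb; ring.
by have [a [b ->]] := cdp_surj x; rewrite cd_conjp !cd_trp.
Qed.

Lemma cd_normZ n c (x : cd F n) : cd_norm (c *: x) = c ^+ 2 * cd_norm x.
Proof.
elim: n x => [|n IHn] x.
  by have [a [b ->]] := cdb_surj x; rewrite cdbZ !cd_normb; ring.
by have [a [b ->]] := cdp_surj x; rewrite cdpZ !cd_normp !IHn; ring.
Qed.

Lemma cd_normN n (x : cd F n) : cd_norm (- x) = cd_norm x.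
Proof. by rewrite -scaleN1r cd_normZ sqrrN expr1n mul1r. Qed.

Lemma cd_norm_conj n (x : cd F n) : cd_norm (cd_conj x) = cd_norm x.
Proof.
elim: n x => [|n IHn] x.
  by have [a [b ->]] := cdb_surj x; rewrite cd_conjb !cd_normb; ring.
by have [a [b ->]] := cdp_surj x; rewrite cd_conjp !cd_normp IHn cd_normN.
Qed.

Lemma cd_norm0 n : cd_norm (0 : cd F n) = 0.
Proof. by rewrite -(scale0r (0 : cd F n)) cd_normZ expr0n mul0r. Qed.

Lemma cd_norm1 n : cd_norm (cd_one F n) = 1.
Proof.
elim: n => [|n IHn]; first by rewrite cd_one0 cd_normb; ring.
by rewrite cd_oneS cd_normp IHn cd_norm0 mulr0 subr0.
Qed.

End Algebra.

(** * Separation of coefficients by elements of equal trace and norm *)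

Section Sphere.
Variables (F : fieldType) (mu : F) (g : nat -> F).

Local Notation "x ** y" := (cd_mul mu g x y) (at level 40, left associativity).
Local Notation norm := (cd_norm mu g).

Lemma cd_mulp0 n (a b x : cd F n) :
  cdp a b ** cdp x 0 = cdp (a ** x) (b ** cd_conj x).
Proof. by rewrite cd_mulp cd_conj0 !cd_mul0l scaler0 addr0 add0r. Qed.

Lemma cd_mul0p n (a b y : cd F n) :
  cdp a b ** cdp 0 y = cdp (g n *: (cd_conj y ** b)) (y ** a).
Proof. by rewrite cd_mulp cd_conj0 !cd_mul0r addr0 add0r. Qed.

Lemma cdp00 n : cdp 0 0 = 0 :> cd F n.+1.
Proof. by rewrite /cdp -lock. Qed.

Lemma cdp_eq0 n (x y : cd F n) : cdp x y = 0 -> x = 0 /\ y = 0.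
Proof. by rewrite -cdp00; apply: cdp_inj. Qed.

Lemma cd_inFZ n (x : cd F n) : cd_inF x <-> exists c, x = c *: cd_one F n.
Proof. by split=> -[c]; rewrite -?cd_scalarZ => ->; exists c; rewrite ?cd_scalarZ. Qed.

Lemma cd_inFb (a b : F) : cd_inF (cdb a b) <-> b = 0.
Proof.
split; last by move->; exists a; rewrite /cdb -lock.
by case=> c; rewrite /cdb -lock => -[].
Qed.

Lemma cd_inFp n (x y : cd F n) : cd_inF (cdp x y) <-> cd_inF x /\ y = 0.
Proof.
split; last by case=> -[c ->] ->; exists c; rewrite /cdp -lock.
by case=> c; rewrite /cdp -lock => -[-> ->]; split=> //; exists c.
Qed.

Lemma cd_inF_dec n (x : cd F n) : cd_inF x \/ ~ cd_inF x.
Proof.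
elim: n x => [|n IHn] x.
  have [a [b ->]] := cdb_surj x; rewrite cd_inFb.
  by have [|/eqP] := eqVneq b 0; [left | right].
have [y [z ->]] := cdp_surj x; rewrite cd_inFp.
have [->|/eqP nz] := eqVneq z 0; last by right; case.
by case: (IHn y) => Fy; [left | right; case].
Qed.

Lemma cd_inF_conj n (x : cd F n) : cd_inF (cd_conj x) -> cd_inF x.
Proof.
rewrite !cd_inFZ => -[c xc]; exists c.
by rewrite -[x]cd_conjK xc cd_conjZ cd_conj1.
Qed.

Lemma cd_inF_scale n c (x : cd F n) : c != 0 -> cd_inF (c *: x) -> cd_inF x.
Proof.
move=> c0; rewrite !cd_inFZ => -[d xd]; exists (c^-1 * d).
by rewrite -scalerA -xd scalerA mulVf ?scale1r.
Qed.

(** By [cd_sqr] such [r] are roots of p_l. A root of p_l lying in F may fail the condition, as when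
    p_l has two distinct roots in F. *)
Definition conj_sphere n (l r : cd F n) : Prop :=
  cd_tr r = cd_tr l /\ norm r = norm l.

Lemma conj_sphere_conj n (l r : cd F n) :
  conj_sphere (cd_conj l) r -> conj_sphere l (cd_conj r).
Proof. by rewrite /conj_sphere !cd_tr_conj !cd_norm_conj. Qed.

(* The witness comes from parametrising the conic a^2 + a b + mu b^2 = 1 by the
   lines a = 1 + t b through (1, 0). *)
Lemma char2_norm1_nonscalar n (t : F) : 2 = 0 :> F -> t ^+ 2 + t + mu != 0 ->
  exists2 d : cd F n, ~ cd_inF d & norm d = 1.
Proof.
move=> ch2 nzq; elim: n => [|n [d Fd nd]]; last first.
  exists (cdp d 0); first by rewrite cd_inFp => -[].
  by rewrite cd_normp nd cd_norm0 mulr0 subr0.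
set b := (t ^+ 2 + t + mu)^-1; exists (cdb (1 + t * b) b).
  by rewrite cd_inFb => /eqP; rewrite invr_eq0 (negPf nzq).
have bq : b * (t ^+ 2 + t + mu) = 1 by rewrite mulVf.
rewrite cd_normb.
have -> : (1 + t * b) ^+ 2 + (1 + t * b) * b - mu * b ^+ 2 =
  1 + 2 * (t * b + b - mu * b ^+ 2) + b * (b * (t ^+ 2 + t + mu) - 1) by ring.
by rewrite bq subrr mulr0 ch2 mul0r !addr0.
Qed.

(** The test for the leading coefficient of a remainder a x + b: subtracting a l + b = 0 from a r +
    b = 0 leaves a (r - l) = 0. Quantifying over all [l] and [a] makes it usable as an induction
    hypothesis. *)
Definition sphere_separating n : Prop := forall l a : cd F n, ~ cd_inF l ->
  (forall r, conj_sphere l r -> a ** (r - l) = 0) -> a = 0.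

(** The involution reverses products and preserves trace and norm, so it carries left annihilation
    to right annihilation. *)
Lemma sphere_separatingl n : sphere_separating n -> forall l a : cd F n,
  ~ cd_inF l -> (forall r, conj_sphere l r -> (r - l) ** a = 0) -> a = 0.
Proof.
move=> sep l a Fl al0.
rewrite -[a]cd_conjK (sep (cd_conj l) (cd_conj a)) ?cd_conj0 //.
  by move/cd_inF_conj.
move=> r /conj_sphere_conj/al0 r0.
by rewrite -[r]cd_conjK -cd_conjB -cd_conjM r0 cd_conj0.
Qed.

(** The conjugate alone suffices: for l = c + b l1, conj l - l = b (1 - 2 l1), and (1 - 2 l1)^2 = 4
    mu + 1 is invertible. *)
Lemma sphere_separating0 : 4 * mu + 1 != 0 -> sphere_separating 0.
Proof.
move=> hmu l a; have [c [b ->]] := cdb_surj l; have [a1 [a2 ->]] := cdb_surj a.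
rewrite cd_inFb => /eqP nzb /(_ (cd_conj (cdb c b))).
rewrite /conj_sphere cd_tr_conj cd_norm_conj => /(_ (conj erefl erefl)).
rewrite cd_conjb cdbN cdbD cd_mulb /cdb -!lock => -[e1 e2].
have {}e1 : b * (a1 - 2 * mu * a2) = 0 by rewrite -[RHS]e1; ring.
have {}e2 : b * (2 * a1 + a2) = 0.
  by apply: oppr_inj; rewrite oppr0 -[RHS]e2; ring.
(* Eliminating [a1] from the two coordinate equations leaves the determinant 4 mu + 1. *)
have a20 : a2 = 0.
  have /eqP : a2 * (b * (4 * mu + 1)) = 0.
    transitivity (b * (2 * a1 + a2) - 2 * (b * (a1 - 2 * mu * a2))).
      by ring.
    by rewrite e1 e2 mulr0 subr0.
  by rewrite !mulf_eq0 (negPf nzb) (negPf hmu) !orbF => /eqP.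
suff -> : a1 = 0 by rewrite a20.
move/eqP: e1; rewrite a20 mulr0 subr0 mulf_eq0 (negPf nzb).
by move/eqP.
Qed.

Section Step.
Variables (n : nat).
Hypotheses (gn0 : g n != 0) (sep : sphere_separating n).
Variables (a1 a2 : cd F n).

(** If [x] has the trace and norm of [u], then [cdp x v] has those of [cdp u v], and the product
    with [cdp (x - u) 0] splits into a1 (x - u) and a2 conj(x - u). The second is handled on the
    sphere of conj u. *)
Lemma sphere_separating_fst (u v : cd F n) : ~ cd_inF u ->
    (forall r, conj_sphere (cdp u v) r -> cdp a1 a2 ** (r - cdp u v) = 0) ->
  cdp a1 a2 = 0.
Proof.
move=> Fu a0.
have au x : conj_sphere u x -> a1 ** (x - u) = 0 /\ a2 ** cd_conj (x - u) = 0.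
  move=> [tx nx]; have := a0 (cdp x v).
  rewrite /conj_sphere !cd_trp !cd_normp nx tx => /(_ (conj erefl erefl)).
  by rewrite cdpN cdpD subrr cd_mulp0 => /cdp_eq0.
rewrite (sep (a := a1) Fu) => [|x /au[]//].
rewrite (sep (l := cd_conj u) (a := a2)) ?cdp00 // => [/cd_inF_conj //|x].
by move/conj_sphere_conj/au=> [_]; rewrite cd_conjB cd_conjK.
Qed.

(** Multiplying by [cdp 0 y] yields conj(y) a2, up to gamma, and y a1. Both are left
    multiplications, hence [sphere_separatingl], applied at v and at conj v. *)
Lemma sphere_separating_snd (v : cd F n) : ~ cd_inF v ->
    (forall d, conj_sphere v d -> cdp a1 a2 ** cdp 0 (d - v) = 0) ->
  cdp a1 a2 = 0.
Proof.
move=> Fv a0.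
have av d : conj_sphere v d ->
    (d - v) ** a1 = 0 /\ cd_conj (d - v) ** a2 = 0.
  move=> /a0; rewrite cd_mul0p => /cdp_eq0[/eqP].
  by rewrite scaler_eq0 (negPf gn0) /= => /eqP.
rewrite (sphere_separatingl sep (a := a1) Fv) => [|x /av[]//].
rewrite (sphere_separatingl sep (l := cd_conj v) (a := a2)) ?cdp00 //.
  by move/cd_inF_conj.
by move=> d /conj_sphere_conj/av[_]; rewrite cd_conjB cd_conjK.
Qed.

(** Right multiplication by (0, 1) sends (a1, a2) to (gamma a2, a1), which is injective. *)
Lemma cd_mul0p1_eq0 : cdp a1 a2 ** cdp 0 (cd_one F n) = 0 -> cdp a1 a2 = 0.
Proof.
rewrite cd_mul0p cd_conj1 !cd_mul1l => /cdp_eq0[/eqP].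
by rewrite scaler_eq0 (negPf gn0) => /eqP -> ->; rewrite cdp00.
Qed.

End Step.

Lemma sphere_separatingS n : (forall k, (k < n.+1)%N -> g k != 0) ->
  sphere_separating n -> sphere_separating n.+1.
Proof.
move=> hg sep l a; have gn0 : g n != 0 by apply: hg.
have [u [v ->]] := cdp_surj l; have [a1 [a2 ->]] := cdp_surj a.
move=> Fl a0.
case: (cd_inF_dec u) => [Fu|Fu]; last exact: sphere_separating_fst Fu a0.
(* The trace of [cdp u d] does not involve [d], so equality of norms keeps [cdp u d] on the
   sphere. *)
have av d : norm d = norm v -> cdp a1 a2 ** cdp 0 (d - v) = 0.
  move=> nd; have := a0 (cdp u d); rewrite cdpN cdpD subrr; apply.
  by rewrite /conj_sphere !cd_trp !cd_normp nd.
case: (cd_inF_dec v) => [/cd_inFZ[e ve]|Fv]; last first.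
  by apply: sphere_separating_snd Fv _ => // d [_ /av].
have e0 : e != 0.
  by apply/eqP=> e0; apply: Fl; rewrite cd_inFp ve e0 scale0r.
have nv : norm v = e ^+ 2 by rewrite ve cd_normZ cd_norm1 mulr1.
have [//|nza] := eqVneq (cdp a1 a2) 0.
have [ch2|ch2] := eqVneq (2 : F) 0; last first.
  (* Here v = e is scalar, so -v - v = -2 e is a nonzero scalar and [a] kills (0, 1). *)
  apply: (cd_mul0p1_eq0 gn0); have := av (- v); rewrite cd_normN => /(_ erefl).
  have -> : cdp 0 (- v - v) = - (2 * e) *: cdp 0 (cd_one F n).
    by rewrite cdpZ scaler0 ve -scaleNr -scalerDl; congr (cdp _ (_ *: _)); ring.
  rewrite cd_mulZr => /eqP.
  by rewrite scaler_eq0 oppr_eq0 mulf_eq0 (negPf ch2) (negPf e0) => /eqP.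
(* A nonscalar [d] of norm 1 gives e d, nonscalar with the norm e^2 of [v]. Subtracting two
   instances of [av] moves the base point from [v] to e d, where [sphere_separating_snd] applies. *)
have inF1 (d : cd F n) : norm d = 1 -> cd_inF d.
  move=> nd; case: (cd_inF_dec d) => // Fd; case/eqP: nza.
  apply: (sphere_separating_snd gn0 sep (v := e *: d)) => [|x [_]].
    by move/(cd_inF_scale e0).
  have ned : norm (e *: d) = norm v by rewrite cd_normZ nd nv mulr1.
  rewrite ned => /av ax; have ad := av _ ned.
  have -> : cdp 0 (x - e *: d) = cdp 0 (x - v) - cdp 0 (e *: d - v).
    by rewrite cdpN cdpD subr0 opprB addrA subrK.
  by rewrite cd_mulBr ax ad subr0.
(* A nonzero value would produce a nonscalar element of norm 1. The identity for all t then forces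
   mu = 0 at t = 0, and t (t + 1) = 0 in general. *)
have q0 (t : F) : t ^+ 2 + t + mu = 0.
  apply/eqP/negPn/negP=> /(char2_norm1_nonscalar n ch2)[d Fd nd].
  exact: Fd (inF1 _ nd).
have mu0 : mu = 0 by rewrite -[RHS](q0 0); ring.
have F2 (t : F) : t != 0 -> t = -1.
  move=> t0; apply/eqP; rewrite -subr_eq0 opprK -(mulrI_eq0 _ (mulfI t0)).
  by rewrite -[X in _ == X](q0 t) mu0; apply/eqP; ring.
(* From here on F is F_2 and mu = 0. *)
case: n => [|n] in hg sep l a a1 a2 u v Fl a0 Fu av ve nv nza inF1 gn0 *; last first.
  have [] : ~ cd_inF (cdp 0 (cd_one F n)).
    rewrite cd_inFp => -[_ /(congr1 (@cd_norm F mu g n))]; rewrite cd_norm1 cd_norm0.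
    by move/eqP; rewrite oner_eq0.
  apply: inF1; rewrite cd_normp cd_norm1 cd_norm0 (F2 (g n)); first by ring.
  exact: hg.
have [c uc] : exists c, u = cdb c 0.
  by case: Fu => c ->; exists c; rewrite /cdb -lock.
(* For w of norm 0, (c + 1, w) is on the sphere of l: the trace changes by 2 = 0, and (c + 1)^2 =
   c^2 + 1 is the norm of l since gamma = e = -1. *)
pose r w := cdp (cdb (c + 1) 0) w - cdp u v.
have aw (w : cd F 0) : norm w = 0 -> cdp a1 a2 ** r w = 0.
  move=> nw; apply: a0; rewrite /conj_sphere !cd_trp uc !cd_trb.
  rewrite !cd_normp nw nv (F2 _ gn0) (F2 _ e0) !cd_normb; split.
    by transitivity (c *+ 2 + 0 + 2); [ring | rewrite ch2 addr0].
  by rewrite -[RHS]addr0 -[X in _ = _ + X](mul0r c) -[X in _ = _ + X * c]ch2; ring.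
apply: (cd_mul0p1_eq0 gn0).
have rB w w' : r w - r w' = cdp 0 (w - w').
  by rewrite /r opprB addrA subrK cdpN cdpD subrr.
(* With mu = 0 the idempotents l1 and 1 - l1 have norm 0, and they add up to 1. *)
have -> : cdp 0 (cd_one F 0) =
    (r (cdb 0 1) - r (cdb 0 0)) + (r (cdb 1 (-1)) - r (cdb 0 0)).
  rewrite !rB cdpD !cdbN !cdbD cd_one0 addr0.
  by congr (cdp _ (cdb _ _)); ring.
rewrite cd_mulDr cd_mulBr [X in _ + X]cd_mulBr !aw ?subrr ?addr0 //.
all: by rewrite cd_normb mu0; ring.
Qed.

Lemma sphere_separatingP n : 4 * mu + 1 != 0 ->
  (forall k, (k < n)%N -> g k != 0) -> sphere_separating n.
Proof.
move=> hmu; elim: n => [|n IHn] hg; first exact: sphere_separating0.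
by apply: sphere_separatingS => //; apply: IHn => k /ltnW; apply: hg.
Qed.

End Sphere.

(** * Division by the characteristic polynomial and evaluation *)

Section Polynomials.
Variables (F : fieldType) (mu : F) (g : nat -> F) (n : nat).
Implicit Types (f h : cpoly F n) (r l a b : cd F n).

Local Notation "x ** y" := (cd_mul mu g x y) (at level 40, left associativity).
Local Notation norm := (cd_norm mu g).
Local Notation pow := (cd_pow mu g).

#[local] Arguments pcoef : simpl never.

Lemma cd_sumE (s : seq (cd F n)) : cd_sum s = \sum_(x <- s) x.
Proof. by elim: s => [|x s IHs]; rewrite ?big_nil // big_cons /= IHs. Qed.

Lemma cd_sum_iota (G : nat -> cd F n) m :
  cd_sum [seq G i | i <- iota 0 m] = \sum_(i < m) G i.
Proof. by rewrite cd_sumE big_map -[in iota _ _](subn0 m) big_mkord. Qed.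

Lemma pcoef_default f k : (size f <= k)%N -> pcoef f k = 0.
Proof. exact: nth_default. Qed.

Lemma pevalE f r m : (size f <= m)%N ->
  peval mu g f r = \sum_(k < m) pcoef f k ** pow r k.
Proof.
move=> le_fm; rewrite /peval cd_sum_iota.
rewrite (big_ord_widen m (fun k => pcoef f k ** pow r k) le_fm).
rewrite big_mkcond /=; apply: eq_bigr => k _; case: ltnP => // le_fk.
by rewrite pcoef_default // cd_mul0l.
Qed.

(** Valid also past the truncation of [pmul]: there each product has a factor beyond the end of its
    list, where coefficients default to 0. *)
Lemma pcoef_pmul f h k :
  pcoef (pmul mu g f h) k = \sum_(i < k.+1) pcoef f i ** pcoef h (k - i).
Proof.
have [lt_k|le_k] := ltnP k (size f + size h).-1.
  by rewrite /pcoef nth_mkseq // cd_sum_iota.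
rewrite pcoef_default ?size_mkseq // big1 // => i _.
have [le_fi|lt_if] := leqP (size f) i.
  by rewrite [pcoef f i]pcoef_default // cd_mul0l.
by rewrite [pcoef h _]pcoef_default ?cd_mul0r //; lia.
Qed.

(** Multiplication by x on coefficient sequences. *)
Definition pshift (c : nat -> cd F n) k : cd F n := if k is k'.+1 then c k' else 0.

(** Coefficients of h p_l, as a three-term formula; [pcoef_mul_charpoly] matches it with [pmul]. *)
Definition charmul l h k : cd F n :=
  norm l *: pcoef h k - cd_tr l *: pshift (pcoef h) k +
  pshift (pshift (pcoef h)) k.

Definition plinear a b k : cd F n := pcoef [:: b; a] k.

Lemma charpolyE l : charpoly mu g l =
  [:: norm l *: cd_one F n; - (cd_tr l *: cd_one F n); cd_one F n].
Proof. by rewrite /charpoly cd_mulconjl -cd_addconj. Qed.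

Lemma pcoef_mul_charpoly l h k :
  pcoef (pmul mu g h (charpoly mu g l)) k = charmul l h k.
Proof.
rewrite pcoef_pmul charpolyE /charmul; case: k => [|[|k]].
- by rewrite big_ord_recr big_ord0 /= cd_mulZr cd_mul1r scaler0 subr0 addr0 add0r.
- rewrite !big_ord_recr big_ord0 /= /pcoef /= cd_mulZr cd_mulNr cd_mulZr !cd_mul1r.
  by rewrite add0r addr0 addrC.
(* In degree k + 2 only the last three summands meet a coefficient of p_l, which has degree 2. *)
rewrite !big_ord_recr /= big1 => [|i _]; last first.
  rewrite [pcoef [:: _; _; _] _]pcoef_default ?cd_mul0r //=.
  by have := ltn_ord i; lia.
rewrite subnn subSnn -addn2 addKn /pcoef /= cd_mulZr cd_mulNr cd_mulZr !cd_mul1r.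
by rewrite add0r addrC addrCA addrC.
Qed.

Lemma charpoly_root_sqr l r : is_root mu g (charpoly mu g l) r <->
  r ** r = cd_tr l *: r - norm l *: cd_one F n.
Proof.
rewrite /is_root charpolyE (@pevalE _ _ 3) // !big_ord_recr big_ord0 /= /pcoef /=.
rewrite add0r cd_mul1r !cd_mul1l cd_mulNl cd_mulZl cd_mul1l.
split=> [e|->]; last by rewrite addrA subrK subrr.
by apply: (addrI (norm l *: cd_one F n - cd_tr l *: r)); rewrite e addrA subrK subrr.
Qed.

(** Powers grow by right multiplication by [r], so the quadratic relation propagates from each
    exponent to the next. *)
Lemma charpoly_root_pow l r k : is_root mu g (charpoly mu g l) r ->
  pow r k.+2 = cd_tr l *: pow r k.+1 - norm l *: pow r k.
Proof.
move=> /charpoly_root_sqr rr; elim: k => [|k IHk].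
  by rewrite /= !cd_mul1l.
by rewrite -[LHS]/(pow r k.+2 ** r) {1}IHk cd_mulBl !cd_mulZl.
Qed.

(** The coefficients of p_l are scalars, so h p_l evaluates to the sum of h_k (r^(k+2) - tr(l)
    r^(k+1) + n(l) r^k), which vanishes termwise by [charpoly_root_pow]. *)
Lemma peval_charmul l h a b f r : is_root mu g (charpoly mu g l) r ->
  (forall k, pcoef f k = charmul l h k + plinear a b k) ->
  peval mu g f r = a ** r + b.
Proof.
move=> root_r fE; set m := maxn (size f) (size h).
rewrite (@pevalE _ _ m.+2); last by rewrite !leqW // leq_maxl.
pose S j := \sum_(k < m) pcoef h k ** pow r (k + j).
have h0 k : (m <= k)%N -> pcoef h k = 0.
  by move=> le_mk; rewrite pcoef_default // (leq_trans _ le_mk) ?leq_maxr.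
have S0 : \sum_(k < m.+2) pcoef h k ** pow r k = S 0.
  rewrite !big_ord_recr /= !h0 // !cd_mul0l !addr0.
  by rewrite /S; apply: eq_bigr => k _; rewrite addn0.
have S1 : \sum_(k < m.+2) pshift (pcoef h) k ** pow r k = S 1.
  rewrite big_ord_recl big_ord_recr /= h0 // !cd_mul0l add0r addr0.
  by rewrite /S; apply: eq_bigr => k _; rewrite addn1.
have S2 : \sum_(k < m.+2) pshift (pshift (pcoef h)) k ** pow r k = S 2.
  rewrite !big_ord_recl /= !cd_mul0l !add0r.
  by rewrite /S; apply: eq_bigr => k _; rewrite addn2.
have SR : \sum_(k < m.+2) plinear a b k ** pow r k = a ** r + b.
  rewrite !big_ord_recl big1 => [|k _]; last by rewrite /plinear /pcoef /= nth_nil cd_mul0l.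
  by rewrite /plinear /pcoef /= cd_mul1r cd_mul1l addr0 addrC.
have -> : \sum_(k < m.+2) pcoef f k ** pow r k =
    norm l *: S 0 - cd_tr l *: S 1 + S 2 + (a ** r + b).
  rewrite -S0 -S1 -S2 -SR !scaler_sumr -sumrB -!big_split /=.
  by apply: eq_bigr => k _; rewrite fE /charmul !(cd_mulDl, cd_mulNl) !cd_mulZl.
suff -> : S 2 = cd_tr l *: S 1 - norm l *: S 0.
  by rewrite [X in X + _]addrA subrK subrr add0r.
rewrite !scaler_sumr -sumrB; apply: eq_bigr => k _.
by rewrite addn2 addn1 addn0 (charpoly_root_pow _ root_r) cd_mulBr !cd_mulZr.
Qed.

(** Horner-style induction on f = c + x f': the remainder of f' is updated by x (a x + b) = a p_l +
    (b + tr(l) a) x - n(l) a. *)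
Lemma charpoly_division l f : exists h a b,
  forall k, pcoef f k = charmul l h k + plinear a b k.
Proof.
elim: f => [|c f [h [a [b fE]]]].
  exists [::], 0, 0 => k; rewrite /charmul /plinear /pcoef.
  by case: k => [|[|k]] /=; rewrite ?nth_nil !scaler0 subrr !addr0.
exists (a :: h), (b + cd_tr l *: a), (c - norm l *: a) => k.
rewrite /charmul /plinear /pcoef; case: k => [|k] /=.
  by rewrite scaler0 subr0 addr0 addrC subrK.
have := fE k; rewrite /charmul /plinear /pcoef => ->.
case: k => [|[|k]] /=; rewrite ?nth_nil ?scaler0 ?subr0 ?addr0 //.
by rewrite [b + _]addrC addrA subrK.
Qed.

End Polynomials.

(** * Spherical roots and divisibility by p_l *)

Theorem theorem3p12 (F : fieldType) (mu : F) (g : nat -> F) (n : nat)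
  (hmu : 4 * mu + 1 != 0) (hg : forall k, (k < n)%N -> g k != 0)
  (f : cpoly F n) (l : cd F n) (hl : ~ cd_inF l) :
  spherical_root mu g f l <->
  exists h : cpoly F n, peq f (pmul mu g h (charpoly mu g l)).
Proof.
have rootl : is_root mu g (charpoly mu g l) l.
  by rewrite charpoly_root_sqr cd_sqr.
split=> [[fl0 _ fs0]|[h fh]]; last first.
  (* A multiple of p_l is the case of remainder 0 x + 0 in [peval_charmul]. *)
  have fr0 r : is_root mu g (charpoly mu g l) r -> is_root mu g f r.
    move=> /peval_charmul evalr; rewrite /is_root (evalr h 0 0).
      by rewrite cd_mul0l addr0.
    move=> k; rewrite fh pcoef_mul_charpoly /plinear /pcoef.
    by case: k => [|[|k]]; rewrite /= ?nth_nil addr0.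
  by split=> //; apply: fr0.
have [h [a [b fE]]] := charpoly_division mu g l f.
have ar r : conj_sphere mu g l r -> cd_mul mu g a r + b = 0.
  move=> [tr nr]; have rootr : is_root mu g (charpoly mu g l) r.
    by rewrite charpoly_root_sqr cd_sqr tr nr.
  by rewrite -(peval_charmul rootr fE); apply: fs0.
have al : cd_mul mu g a l + b = 0 by apply: ar.
have a0 : a = 0.
  apply: (sphere_separatingP hmu hg hl) => r /ar are0.
  by rewrite cd_mulBr; apply/eqP; rewrite subr_eq0 -(inj_eq (addIr b)) are0 al.
have b0 : b = 0 by rewrite a0 cd_mul0l add0r in al.
exists h => k; rewrite fE pcoef_mul_charpoly a0 b0 /plinear /pcoef.
by case: k => [|[|k]]; rewrite /= ?nth_nil addr0.
Qed.
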